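(* Suppose there is a polynomial $q$ such that for every $n\ge1$ the system $F_0=F_1=\dots=F_n=0$ over $\mathbb{Q}(y)[x_1,\dots,x_n]$, where $F_0=y+\sum_{i=1}^n2^{i-1}x_i$ and $F_i=x_i^2-x_i$ for $1\le i\le n$, has an IPS-LIN$_{\mathbb{Q}(y)}$ certificate $H_0,\dots,H_n$ in which every $H_i$ is computed by a constant-free algebraic circuit over $\mathbb{Q}(y)$ of size at most $q(n)$. Then the $\tau$-conjecture is false.
   Context: $\mathbb{Q}(y)$ is the field of rational functions $P(y)/Q(y)$ with $P,Q\in\mathbb{Q}[y]$, $Q\neq0$. An IPS-LIN$_{\mathbb{Q}(y)}$ certificate of the unsatisfiability of a system $F_0=\dots=F_m=0$ with $F_i\in\mathbb{Q}(y)[x_1,\dots,x_n]$ is a tuple $(H_0,\dots,H_m)$ with $H_i\in\mathbb{Q}(y)[x_1,\dots,x_n]$ such that $\sum_i F_iH_i=1$ as a formal identity. An algebraic circuit is a finite DAG whose leaves are labelled by variables or constants and whose internal nodes are $+$ or $\times$ gates of fan-in two; size is the number of nodes. A constant-free circuit over $\mathbb{Q}(y)$ is such a circuit whose constant leaves are among $0,1,-1,y$ (the $x_i$ being the variables), which may also contain division gates $u\div v$ where the subcircuit at $v$ contains no $x$-variables and computes a nonzero element of $\mathbb{Q}(y)$. For $f\in\mathbb{Z}[x]$, $\tau(f)$ is the minimal size of a constant-free division-free circuit over $\mathbb{Z}$ (leaves $0,1,-1$ and the variable) computing $f$, and $z(f)$ is the number of distinct integer roots of $f$. The $\tau$-conjecture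 states: there is a universal constant $c$ such that $(1+\tau(f))^c\ge z(f)$ for every univariate $f\in\mathbb{Z}[x]$ (with $f\neq 0$). *)

(* Defs.v *)
From HB Require Import structures.
From mathcomp Require Import all_boot all_order all_algebra.
From mathcomp Require Import finmap mpoly.
From mathcomp Require Import boolp classical_sets functions cardinality.

Set Implicit Arguments.
Unset Strict Implicit.
Unset Printing Implicit Defensive.

Import Order.TTheory GRing.Theory Num.Theory.
Local Open Scope ring_scope.

Inductive gate (L V : Type) : Type :=
  | Leaf of L
  | Add of V & V
  | Mul of V & V
  | Div of V & V.
Arguments Leaf {L V} _.
Arguments Add {L V} _ _.
Arguments Mul {L V} _ _.
Arguments Div {L V} _ _.

Definition inputs (L V : Type) (g : gate L V) : seq V :=
  match g with
  | Leaf _ => [::]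
  | Add a b => [:: a; b]
  | Mul a b => [:: a; b]
  | Div a b => [:: a; b]
  end.

Definition input_rel (L : Type) (V : finType) (lab : V -> gate L V) : rel V :=
  fun u w => w \in inputs (lab u).

Definition acyclic (V : finType) (e : rel V) : Prop :=
  forall u w, e u w -> ~~ connect e w u.

(* The edges point from a gate to its inputs; both inputs of a gate may be the
   same node. *)
Record circuit (L : Type) : Type := Circuit {
  node : finType;
  label : node -> gate L node;
  output : node;
  circuit_acyclic : acyclic (input_rel label) }.

Definition circuit_size (L : Type) (C : circuit L) : nat := #|node C|.

Definition subcircuit (L : Type) (C : circuit L) (v : node C) : pred (node C) :=
  connect (input_rel (@label L C)) v.

Definition division_free (L : Type) (C : circuit L) : Prop :=
  forall u a b : node C, label u <> Div a b.

(* Acyclicity makes such an assignment val of values to the nodes unique. *)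
Definition valuation (L : Type) (R : unitRingType) (leafval : L -> R)
    (C : circuit L) (val : node C -> R) : Prop :=
  forall u : node C, val u =
    match label u with
    | Leaf l => leafval l
    | Add a b => val a + val b
    | Mul a b => val a * val b
    | Div a b => val a / val b
    end.

Notation Qy := {fraction {poly rat}}.

Definition y_of_Qy : Qy := tofrac 'X.

Inductive Qy_leaf (n : nat) : Type :=
  | QyZero | QyOne | QyMinusOne | QyY | QyVar of 'I_n.
Arguments QyZero {n}.
Arguments QyOne {n}.
Arguments QyMinusOne {n}.
Arguments QyY {n}.

Definition Qy_leafval (n : nat) (l : Qy_leaf n) : {mpoly Qy[n]} :=
  match l with
  | QyZero => 0
  | QyOne => 1
  | QyMinusOne => -1
  | QyY => y_of_Qy%:MP
  | QyVar i => 'X_i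
  end.

(* At an admissible division gate the divisor is a nonzero constant c%:MP, whose
   ring inverse in {mpoly Qy[n]} is c^-1%:MP. *)
Definition divisions_admissible (n : nat) (C : circuit (Qy_leaf n))
    (val : node C -> {mpoly Qy[n]}) : Prop :=
  forall u a b : node C, label u = Div a b ->
    (forall w i, subcircuit b w -> label w <> Leaf (QyVar i)) /\
    (exists2 c : Qy, c != 0 & val b = c%:MP).

Definition Qy_computes (n : nat) (C : circuit (Qy_leaf n))
    (p : {mpoly Qy[n]}) : Prop :=
  exists val : node C -> {mpoly Qy[n]},
    [/\ valuation (@Qy_leafval n) val,
        divisions_admissible val
      & val (output C) = p].

Definition IPS_LIN_certificate (n m : nat) (F H : 'I_m.+1 -> {mpoly Qy[n]}) :
    Prop :=
  \sum_(i < m.+1) F i * H i = 1.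

(* The variable x_i is 'X_j with j = i - 1, and the polynomial F_i is obtained at
   the index lift ord0 j. *)
Definition BVP_system (n : nat) (i : 'I_n.+1) : {mpoly Qy[n]} :=
  if unlift ord0 i is Some j then 'X_(j : 'I_n) ^+ 2 - 'X_(j : 'I_n)
  else y_of_Qy%:MP + \sum_(j < n) (2 ^ j)%N%:R * 'X_j.

Inductive Z_leaf : Type := ZZero | ZOne | ZMinusOne | ZVar.

Definition Z_leafval (l : Z_leaf) : {poly int} :=
  match l with
  | ZZero => 0
  | ZOne => 1
  | ZMinusOne => -1
  | ZVar => 'X
  end.

Definition Z_computes (C : circuit Z_leaf) (f : {poly int}) : Prop :=
  division_free C /\
  exists2 val : node C -> {poly int}, valuation Z_leafval val
    & val (output C) = f.

Definition has_Z_circuit (f : {poly int}) (s : nat) : Prop :=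
  exists2 C : circuit Z_leaf, Z_computes C f & circuit_size C = s.

Lemma acyclic_of_rank (V : finType) (e : rel V) (r : V -> nat) :
  (forall u w, e u w -> (r w < r u)%N) -> acyclic e.
Proof.
move=> re u w uw; apply/negP => /connectP[p].
have le_last : forall x, path e x p -> (r (last x p) <= r x)%N.
  elim: p => //= z p IHp x /andP[xz zp].
  exact: leq_trans (IHp z zp) (ltnW (re _ _ xz)).
move=> /le_last le_p u_last; have := re _ _ uw.
by rewrite ltnNge {1}u_last le_p.
Qed.

Lemma rank_of_acyclic (V : finType) (e : rel V) : acyclic e ->
  forall u w, e u w -> (#|connect e w| < #|connect e u|)%N.
Proof.
move=> acy u w uw; apply: proper_card; apply/fintype.properP; split.
  apply/fintype.subsetP => z wz; exact: connect_trans (connect1 uw) wz.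
by exists u; [exact: connect0 | exact: acy uw].
Qed.

Section CombineCircuits.
Variables (C1 C2 : circuit Z_leaf) (mul : bool).

Let V : finType := option (node C1 + node C2)%type.

Definition map_gate (A B : Type) (h : A -> B) (g : gate Z_leaf A) :
    gate Z_leaf B :=
  match g with
  | Leaf l => Leaf l
  | Add a b => Add (h a) (h b)
  | Mul a b => Mul (h a) (h b)
  | Div a b => Div (h a) (h b)
  end.

Let lab (u : V) : gate Z_leaf V :=
  match u with
  | Some (inl a) => map_gate (fun x => Some (inl x)) (label a)
  | Some (inr a) => map_gate (fun x => Some (inr x)) (label a)
  | None => (if mul then Mul else Add)
              (Some (inl (output C1))) (Some (inr (output C2)))
  end.

Let rank (u : V) : nat :=
  match u with
  | Some (inl a) => #|connect (input_rel (@label _ C1)) a|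
  | Some (inr a) => #|connect (input_rel (@label _ C2)) a|
  | None => (#|node C1| + #|node C2|).+1
  end.

Lemma combine_acyclic : acyclic (input_rel lab).
Proof.
have inputs_map (A B : eqType) (h : A -> B) g :
  inputs (map_gate h g) = map h (inputs g) by case: g.
apply: (@acyclic_of_rank _ _ rank) => u w; rewrite /input_rel.
case: u => [[a|a]|] /=.
- rewrite inputs_map => /mapP[b ab ->] /=.
  exact: rank_of_acyclic (@circuit_acyclic _ C1) _ _ ab.
- rewrite inputs_map => /mapP[b ab ->] /=.
  exact: rank_of_acyclic (@circuit_acyclic _ C2) _ _ ab.
have -> : inputs ((if mul then Mul else Add) (Some (inl (output C1)))
    (Some (inr (output C2))) : gate Z_leaf V) =
    [:: Some (inl (output C1)); Some (inr (output C2))] by case: mul.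
rewrite !inE => /orP[]/eqP-> /=; rewrite ltnS.
  exact: leq_trans (max_card _) (leq_addr _ _).
exact: leq_trans (max_card _) (leq_addl _ _).
Qed.

Definition combine : circuit Z_leaf := Circuit None combine_acyclic.

Lemma combine_computes (f g : {poly int}) : Z_computes C1 f ->
  Z_computes C2 g -> Z_computes combine (if mul then f * g else f + g).
Proof.
case=> [df1 [v1 val1 out1]] [df2 [v2 val2 out2]]; split.
  case=> [[a|a]|] b c /=; last by case: mul.
    by have := df1 a; case: (label a) => // d e /(_ d e).
  by have := df2 a; case: (label a) => // d e /(_ d e).
exists (fun u : V => match u with
  | Some (inl a) => v1 a
  | Some (inr a) => v2 a
  | None => if mul then f * g else f + g
  end) => // -[[a|a]|] /=.
- by rewrite val1; case: (label a).
- by rewrite val2; case: (label a).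
- by case: mul; rewrite out1 out2.
Qed.

End CombineCircuits.

Lemma has_Z_circuitD f g : (exists s, has_Z_circuit f s) ->
  (exists s, has_Z_circuit g s) -> exists s, has_Z_circuit (f + g) s.
Proof.
move=> [_ [C Cf _]] [_ [D Dg _]].
exists (circuit_size (combine C D false)), (combine C D false) => //.
exact: (combine_computes false Cf Dg).
Qed.

Lemma has_Z_circuitM f g : (exists s, has_Z_circuit f s) ->
  (exists s, has_Z_circuit g s) -> exists s, has_Z_circuit (f * g) s.
Proof.
move=> [_ [C Cf _]] [_ [D Dg _]].
exists (circuit_size (combine C D true)), (combine C D true) => //.
exact: (combine_computes true Cf Dg).
Qed.

Lemma has_Z_circuit_leaf (l : Z_leaf) :
  exists s, has_Z_circuit (Z_leafval l) s.
Proof.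
have acy : acyclic (input_rel (fun _ : unit => Leaf l : gate Z_leaf unit)).
  by move=> u w.
exists 1%N, (Circuit tt acy); last by rewrite /circuit_size card_unit.
by split=> //; exists (fun=> Z_leafval l).
Qed.

Lemma exists_Z_circuit (f : {poly int}) : exists s, `[< has_Z_circuit f s >].
Proof.
suff [s fs] : exists s, has_Z_circuit f s by exists s; apply/asboolP.
have nat_circuit (k : nat) : exists s, has_Z_circuit k%:R s.
  elim: k => [|k IHk]; first exact: (has_Z_circuit_leaf ZZero).
  rewrite -natr1; apply: has_Z_circuitD => //.
  exact: (has_Z_circuit_leaf ZOne).
elim/poly_ind: f => [|f c IHf]; first exact: (has_Z_circuit_leaf ZZero).
apply: has_Z_circuitD.
  by apply: has_Z_circuitM => //; apply: (has_Z_circuit_leaf ZVar).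
case: c => k; first by rewrite -[Posz k]natz polyC_natr.
rewrite NegzE -mulN1r -natz polyCM polyC_natr polyCN.
by apply: has_Z_circuitM => //; apply: (has_Z_circuit_leaf ZMinusOne).
Qed.

Definition tau (f : {poly int}) : nat := ex_minn (exists_Z_circuit f).

Definition int_roots (f : {poly int}) : set int := [set x | root f x]%classic.

Lemma finite_int_roots (f : {poly int}) : f != 0 -> finite_set (int_roots f).
Proof.
move=> f0; apply: contrapT => /(infinite_set_fset (size f))[A Af szA].
have := max_poly_roots f0 _ (fset_uniq A).
rewrite ltnNge szA => /(_ _)/negP; apply => //.
by apply/allP => x xA; exact: Af.
Qed.

(* fset_set is the empty set on infinite sets, hence the value at f = 0 is
   meaningless. *)
Definition z (f : {poly int}) : nat := #|` fset_set (int_roots f)|%fset.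

Definition tau_conjecture : Prop :=
  exists c : nat, forall f : {poly int}, f != 0 -> (z f <= (1 + tau f) ^ c)%N.

(* Main.v *)
Require Import Defs.
From HB Require Import structures.
From mathcomp Require Import all_boot all_order all_algebra.
From mathcomp Require Import finmap mpoly.
From mathcomp Require Import boolp classical_sets cardinality zify.

Set Implicit Arguments.
Unset Strict Implicit.
Unset Printing Implicit Defensive.

Import Order.TTheory GRing.Theory Num.Theory.
Local Open Scope ring_scope.

(** At the 0-1 point whose coordinates are the binary digits of [k < 2^n], all
    [F_i] with [i >= 1] vanish and [F_0] becomes [y + k]; hence [H_0] takes the
    value [1/(y + k)] there. Pushing the divisions of the circuit of [H_0] to the
    output writes its values as [p / Q], where the numerator [p] depends on the
    point but the denominator [Q], a nonzero element of [Z[y]] computed by a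
    division-free circuit of four times the size, does not. So [Q] vanishes at
    [-k] for all [k < 2^n], too many integer roots for its polynomial
    complexity. *)

(** * Induction and evaluation along a circuit *)

Section CircuitInduction.
Variables (L : Type) (C : circuit L).
Local Notation rank := (fun u : node C => #|connect (input_rel (@label L C)) u|).

Lemma input_rank (u w : node C) : w \in inputs (label u) -> (rank w < rank u)%N.
Proof. exact: rank_of_acyclic (@circuit_acyclic _ C) u w. Qed.

(** The number of reachable nodes drops from a gate to its inputs, which makes this induction
    well-founded. *)
Lemma circuit_ind (P : node C -> Prop) :
  (forall u, {in inputs (label u), forall w, P w} -> P u) -> forall u, P u.
Proof.
move=> Pind u; have [k] := ubnP (rank u).
elim: k u => // k IHk u ltk; apply: Pind => w /input_rank ltw.
exact/IHk/(leq_trans ltw).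
Qed.

Variables (R : unitRingType) (leafval : L -> R).

Let gate_value (val : node C -> R) (u : node C) : R :=
  match label u with
  | Leaf l => leafval l
  | Add a b => val a + val b
  | Mul a b => val a * val b
  | Div a b => val a / val b
  end.

(** After [k] rounds of evaluating all gates at once, the nodes of rank below [k] have settled, and
    no rank exceeds the number of nodes. *)
Lemma exists_valuation : exists val : node C -> R, valuation leafval val.
Proof.
pose val k := iter k gate_value (fun=> 0).
have stable k u : (rank u < k)%N -> val k.+1 u = val k u.
  elim: k u => // k IHk u ltk.
  have IH w : w \in inputs (label u) -> val k.+1 w = val k w.
    by move/input_rank => ltw; apply/IHk/(leq_trans ltw).
  rewrite /= /gate_value; case: (label u) IH => //= a b IH.
  - by rewrite -!IH ?mem_head // inE mem_head orbT.
  - by rewrite -!IH ?mem_head // inE mem_head orbT.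
  - by rewrite -!IH ?mem_head // inE mem_head orbT.
exists (val #|node C|.+1) => u.
by rewrite -[LHS]stable // ltnS max_card.
Qed.

End CircuitInduction.

(** * Pushing divisions to the output *)

Definition x_free (n : nat) (C : circuit (Qy_leaf n)) (u : node C) : Prop :=
  forall w i, subcircuit u w -> label w <> Leaf (QyVar i).

Lemma x_free_input (n : nat) (C : circuit (Qy_leaf n)) (u w : node C) :
  w \in inputs (label u) -> x_free u -> x_free w.
Proof.
move=> uw free t i wt; apply: free.
exact: connect_trans (connect1 (uw : input_rel _ u w)) wt.
Qed.

Section Homogenize.
Variables (n : nat) (C : circuit (Qy_leaf n)).

(* Sending the x-variables to 0 is harmless: denominators only involve the
   numerators of x-free nodes. *)
Definition Z_of_Qy_leaf (l : Qy_leaf n) : Z_leaf :=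
  match l with
  | QyZero => ZZero
  | QyOne => ZOne
  | QyMinusOne => ZMinusOne
  | QyY => ZVar
  | QyVar _ => ZZero
  end.

(* The four copies of a node: its numerator, its denominator, and the two
   summands of the numerator of a sum. *)
Let V : finType := (node C * (bool * bool))%type.
Let num (u : node C) : V := (u, (true, true)).
Let den (u : node C) : V := (u, (true, false)).
Let suml (u : node C) : V := (u, (false, true)).
Let sumr (u : node C) : V := (u, (false, false)).

Definition hom_label (v : V) : gate Z_leaf V :=
  let: (u, k) := v in
  match label u, k with
  | Leaf l, (true, true) => Leaf (Z_of_Qy_leaf l)
  | Leaf _, (true, false) => Leaf ZOne
  | Add _ _, (true, true) => Add (suml u) (sumr u)
  | Add a b, (true, false) => Mul (den a) (den b)
  | Add a b, (false, true) => Mul (num a) (den b)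
  | Add a b, (false, false) => Mul (num b) (den a)
  | Mul a b, (true, true) => Mul (num a) (num b)
  | Mul a b, (true, false) => Mul (den a) (den b)
  | Div a b, (true, true) => Mul (num a) (den b)
  | Div a b, (true, false) => Mul (den a) (num b)
  | _, _ => Leaf ZZero
  end.

Lemma hom_acyclic : acyclic (input_rel hom_label).
Proof.
pose rank u := #|connect (input_rel (@label _ C)) u|.
(* Doubling leaves room to place the numerator of a sum one above its two summands, which are copies
   of the same node. *)
apply: (@acyclic_of_rank _ _ (fun v : V => (rank v.1).*2 + v.2.1)%N).
move=> [u k] w; rewrite /input_rel /=.
have le a : a \in inputs (label u) -> (rank a < rank u)%N by exact: input_rank.
case: (label u) le k => [l _ [[] []] //|a b le|a b le|a b le];
  have lea : (rank a < rank u)%N by [apply: le; rewrite mem_head];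
  have leb : (rank b < rank u)%N by [apply: le; rewrite !inE eqxx orbT];
  by case=> [[] []] //=; rewrite !inE => /orP[]/eqP-> /=; lia.
Qed.

Definition hom_circuit : circuit Z_leaf := Circuit (den (output C)) hom_acyclic.

Lemma hom_circuit_size : circuit_size hom_circuit = (4 * circuit_size C)%N.
Proof. by rewrite /circuit_size card_prod card_prod card_bool mulnC. Qed.

Lemma hom_division_free : division_free hom_circuit.
Proof. by move=> [u [[] []]] a b /=; case: (label u). Qed.

Definition Qy_of_Zy (f : {poly int}) : Qy := tofrac (map_poly intr f).

HB.instance Definition _ := GRing.RMorphism.copy Qy_of_Zy
  (@tofrac {poly rat} \o map_poly intr).

Lemma Qy_of_Zy_eq0 f : (Qy_of_Zy f == 0) = (f == 0).
Proof.
rewrite tofrac_eq0 -(inj_eq (map_inj_poly (intr_inj (R := rat)) (mulr0z _))).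
by rewrite rmorph0.
Qed.

Section Values.
Variables (val : node C -> {mpoly Qy[n]}) (zval : V -> {poly int}).
Hypothesis val_valuation : valuation (@Qy_leafval n) val.
Hypothesis val_admissible : divisions_admissible val.
Hypothesis zval_valuation : valuation Z_leafval (zval : node hom_circuit -> _).

(** Denominators can be independent of [e]: only a division moves a numerator into a denominator,
    and a divisor is [x_free]. At other nodes [zval (num u)] has the variables set to 0 and need not
    fit [e], so there some numerator [p] is only shown to exist. *)
Lemma hom_values (e : 'I_n -> int) (u : node C) :
  let x i := Qy_of_Zy (e i)%:P in
  [/\ zval (den u) != 0,
      exists p, (val u).@[x] = Qy_of_Zy p / Qy_of_Zy (zval (den u))
    & x_free u ->
      (val u).@[x] = Qy_of_Zy (zval (num u)) / Qy_of_Zy (zval (den u))].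
Proof.
set x := fun i => _ => /=.
have yE : Qy_of_Zy 'X = y_of_Qy by rewrite /Qy_of_Zy map_polyX.
elim/(@circuit_ind _ C): u => u IH.
have in_l (a b : node C) : a \in [:: a; b] by rewrite mem_head.
have in_r (a b : node C) : b \in [:: a; b] by rewrite !inE eqxx orbT.
have free_in a : a \in inputs (label u) -> x_free u -> x_free a.
  exact: x_free_input.
have := val_valuation u.
have := zval_valuation (den u); have := zval_valuation (num u).
have := zval_valuation (suml u); have := zval_valuation (sumr u).
rewrite /=; case lu: (label u) IH free_in => [l|a b|a b|a b] /= IH free_in.
- move=> _ _ -> -> ->; rewrite oner_eq0 rmorph1 !divr1; split=> //.
    case: l lu => [||||i] lu; [exists 0|exists 1|exists (-1)|exists 'X|].
    + by rewrite meval0 rmorph0 mul0r.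
    + by rewrite meval1 rmorph1 divr1.
    + by rewrite mevalN meval1 rmorphN1 divr1.
    + by rewrite mevalC yE divr1.
    + by exists (e i)%:P; rewrite mevalXU divr1.
  case: l lu => [||||i] lu free.
  + by rewrite meval0 rmorph0.
  + by rewrite meval1 rmorph1.
  + by rewrite mevalN meval1 rmorphN1.
  + by rewrite mevalC yE.
  + by case: (free u i (connect0 _ _)).
- move=> -> -> -> -> ->.
  have [qa [pa Ea] Fa] := IH a (in_l _ _); have [qb [pb Eb] Fb] := IH b (in_r _ _).
  have fq f g r s : r != 0 -> s != 0 -> Qy_of_Zy f / Qy_of_Zy r +
    Qy_of_Zy g / Qy_of_Zy s = Qy_of_Zy (f * s + g * r) / Qy_of_Zy (r * s).
    move=> r0 s0; rewrite rmorphD !rmorphM /=.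
    by apply: addf_div; rewrite Qy_of_Zy_eq0.
  split; first by rewrite mulf_neq0.
    by eexists; rewrite mevalD Ea Eb fq.
  move=> free; rewrite mevalD Fa ?Fb ?fq //; exact: free_in.
- move=> _ _ -> -> ->.
  have [qa [pa Ea] Fa] := IH a (in_l _ _); have [qb [pb Eb] Fb] := IH b (in_r _ _).
  split; first by rewrite mulf_neq0.
    by exists (pa * pb); rewrite mevalM Ea Eb mulf_div !rmorphM.
  move=> free; rewrite mevalM Fa ?Fb ?mulf_div ?rmorphM //; exact: free_in.
move=> _ _ -> -> ->.
have [qa [pa Ea] Fa] := IH a (in_l _ _); have [qb _ Fb] := IH b (in_r _ _).
have [freeb [c c0 vb]] := val_admissible lu.
have Ec : c = Qy_of_Zy (zval (num b)) / Qy_of_Zy (zval (den b)).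
  by rewrite -Fb // vb mevalC.
have pb0 : zval (num b) != 0.
  by apply: contraNneq c0 => nb0; rewrite Ec nb0 rmorph0 mul0r.
(* The divisor is a nonzero constant, so its ring inverse is again a constant and evaluation
   commutes with this division. *)
have Ediv : (val a / val b).@[x] =
    (val a).@[x] * (Qy_of_Zy (zval (den b)) / Qy_of_Zy (zval (num b))).
  by rewrite mevalM vb -(fmorphV (@mpolyC n Qy)) /= mevalC Ec invf_div.
split; first by rewrite mulf_neq0.
  by exists (pa * zval (den b)); rewrite Ediv Ea mulf_div !rmorphM.
by move=> free; rewrite Ediv Fa ?mulf_div ?rmorphM //; exact: free_in.
Qed.

End Values.

(** What matters is the order of quantifiers: one [Q] serves every integer point [e]. *)
Lemma common_denominator (p : {mpoly Qy[n]}) : Qy_computes C p ->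
  exists Q : {poly int}, [/\ Q != 0, has_Z_circuit Q (4 * circuit_size C)
    & forall e : 'I_n -> int, exists f : {poly int},
        p.@[fun i => Qy_of_Zy (e i)%:P] = Qy_of_Zy f / Qy_of_Zy Q].
Proof.
move=> [val [val_ok adm <-]].
have [zval zval_ok] := @exists_valuation _ hom_circuit _ Z_leafval.
have hom := hom_values val_ok adm zval_ok.
exists (zval (den (output C))); split.
- by have [] := hom (fun=> 0) (output C).
- exists hom_circuit; last exact: hom_circuit_size.
  split; [exact: hom_division_free | by exists zval].
- by move=> e; have [] := hom e (output C).
Qed.

End Homogenize.

(** * The certificate at 0-1 points *)

Lemma binary_digits (n k : nat) : (k < 2 ^ n)%N ->
  exists e : 'I_n -> bool, (\sum_(j < n) 2 ^ j * e j)%N = k.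
Proof.
move=> ltk; exists (fun j => odd (k %/ 2 ^ j)).
elim: n k ltk => [|n IHn] k ltk; first by rewrite big_ord0; lia.
rewrite big_ord_recl expn0 divn1 mul1n -[RHS]odd_double_half; congr (_ + _)%N.
(* The digits of [k] above the lowest are those of [k./2]. *)
rewrite -[in RHS](IHn k./2); last by rewrite expnS in ltk; lia.
rewrite -muln2 big_distrl /=; apply: eq_bigr => j _.
by rewrite expnS divnMA divn2 -mulnA mulnC.
Qed.

Lemma BVP_certificate_value (n : nat) (H : 'I_n.+1 -> {mpoly Qy[n]}) (k : nat) :
  IPS_LIN_certificate (@BVP_system n) H -> (k < 2 ^ n)%N ->
  exists e : 'I_n -> int,
    Qy_of_Zy ('X + k%:R) * (H ord0).@[fun i => Qy_of_Zy (e i)%:P] = 1.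
Proof.
move=> cert /binary_digits[e ek]; exists (fun i => (e i)%:R).
set x := fun i => _.
have xE i : x i = (e i)%:R by rewrite /x polyC_natr rmorph_nat.
move/(congr1 (meval x)): cert; rewrite meval1 raddf_sum big_ord_recl /= big1.
  rewrite addr0 mevalM /BVP_system unlift_none mevalD mevalC.
  rewrite raddf_sum /= => <-; congr (_ * _).
  rewrite rmorphD rmorph_nat /= /Qy_of_Zy map_polyX -ek natr_sum.
  congr (_ + _); apply: eq_bigr => j _.
  by rewrite mevalM rmorph_nat mevalXU xE natrM.
(* The terms of positive index vanish since 0 and 1 are idempotent. *)
move=> j _; rewrite mevalM /BVP_system liftK mevalB rmorphXn /= mevalXU xE.
by case: (e j); rewrite ?expr1n ?expr0n subrr mul0r.
Qed.

(** * A polynomial with small circuits and many integer roots *)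

Lemma tau_le (f : {poly int}) (s : nat) : has_Z_circuit f s -> (tau f <= s)%N.
Proof. by move=> fs; rewrite /tau; case: ex_minnP => m _; apply; apply/asboolP. Qed.

Lemma z_ge (f : {poly int}) (s : seq int) : f != 0 -> uniq s ->
  all (root f) s -> (size s <= z f)%N.
Proof.
move=> f0 us /allP rs; apply: uniq_leq_size => // i /rs fi.
(* Finiteness of the root set rules out the default empty value of [fset_set]. *)
by rewrite in_fset_set ?inE //; exact: finite_int_roots.
Qed.

Lemma certificate_tau_z (n : nat) (H : 'I_n.+1 -> {mpoly Qy[n]})
    (C : circuit (Qy_leaf n)) :
  IPS_LIN_certificate (@BVP_system n) H -> Qy_computes C (H ord0) ->
  exists Q : {poly int},
    [/\ Q != 0, (tau Q <= 4 * circuit_size C)%N & (2 ^ n <= z Q)%N].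
Proof.
move=> cert /common_denominator[Q [Q0 /tau_le tauQ HQ]]; exists Q; split=> //.
pose s := [seq - k%:Z | k <- iota 0 (2 ^ n)].
have <- : size s = (2 ^ n)%N by rewrite size_map size_iota.
apply: z_ge => //.
  rewrite map_inj_uniq ?iota_uniq // => i j /eqP.
  by rewrite eqr_opp => /eqP[].
apply/allP => _ /mapP[k + ->]; rewrite mem_iota => /= ltk.
have [e He] := BVP_certificate_value cert ltk; have [f Ef] := HQ e.
(* Clearing the denominator in [(y + k) * f / Q = 1] gives [(y + k) * f = Q], already in Z[y] by
   injectivity, so [-k] is a root of [Q]. *)
move: He; rewrite Ef mulrA => /divr1_eq /eqP.
rewrite -rmorphM -subr_eq0 -rmorphB Qy_of_Zy_eq0 subr_eq0 => /eqP <-.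
by rewrite /root hornerM hornerD hornerX -polyC_natr hornerC natz addNr mul0r.
Qed.

(** * Growth estimates and the contradiction *)

Lemma poly_nat_bound (q : {poly rat}) : exists K d : nat,
  forall n : nat, (1 <= n)%N -> q.[n%:R] <= (K * n ^ d)%:R.
Proof.
elim/poly_ind: q => [|p c [K [d bound]]].
  by exists 0%N, 0%N => n _; rewrite horner0.
(* As [n ^ d.+1 >= 1], the constant term [c] is absorbed into the factor. *)
exists (K + Num.bound `|c|)%N, d.+1 => n n1.
rewrite hornerMXaddC mulnDl natrD; apply: lerD.
  by rewrite expnSr mulnA natrM ler_wpM2r ?bound.
apply: le_trans (ler_norm c) _.
apply: le_trans (ltW (archi_boundP (normr_ge0 c))) _.
by rewrite ler_nat leq_pmulr // expn_gt0 n1.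
Qed.

Lemma exp2_beats_linear (a b : nat) : exists m : nat, (a * m + b < 2 ^ m)%N.
Proof.
(* With [m = 2t], [2 ^ m] is the square of [2 ^ t >= t + 1], and [(t + 1)^2 > 2at + b] because [2a]
   and [b] are at most [t]. *)
pose t := (2 * a + b)%N; exists (t + t)%N.
apply: (@leq_trans (t.+1 * t.+1)%N); first by rewrite /t; nia.
by rewrite expnD; apply: leq_mul; apply: ltn_expl.
Qed.

Lemma exp2_beats_poly (M d : nat) : exists2 n, (1 <= n)%N & (M * n ^ d < 2 ^ n)%N.
Proof.
have [m ltm] := exp2_beats_linear d M.
(* For [n = 2 ^ m] and [M < 2 ^ M], it is enough to compare the exponents [d * m + M] and
   [2 ^ m]. *)
exists (2 ^ m)%N; first by rewrite expn_gt0.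
apply: leq_trans (_ : 2 ^ (d * m + M) <= _)%N; last by rewrite leq_exp2l // ltnW.
rewrite -expnM [(M * _)%N]mulnC [(m * d)%N]mulnC expnD ltn_pmul2l ?expn_gt0 //.
exact: ltn_expl.
Qed.

Theorem theorem3p11 :
  (exists q : {poly rat}, forall n : nat, (1 <= n)%N ->
    exists H : 'I_n.+1 -> {mpoly Qy[n]},
      IPS_LIN_certificate (@BVP_system n) H /\
      forall i : 'I_n.+1, exists C : circuit (Qy_leaf n),
        Qy_computes C (H i) /\ (circuit_size C)%:R <= q.[n%:R]) ->
  ~ tau_conjecture.
Proof.
move=> [q certs] [c tauz]; have [K [d qK]] := poly_nat_bound q.
(* This [n] contradicts the chain [2 ^ n <= z Q <= (1 + tau Q) ^ c <= ((1 + 4 * K) * n ^ d) ^ c]. *)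
have [n n1] := exp2_beats_poly ((1 + 4 * K) ^ c) (d * c).
apply/negP; rewrite -leqNgt.
have [H [cert /(_ ord0)[C [CH sizeC]]]] := certs n n1.
have [Q [Q0 tauQ zQ]] := certificate_tau_z cert CH.
have {}sizeC : (circuit_size C <= K * n ^ d)%N.
  by rewrite -(ler_nat rat); exact: le_trans sizeC (qK n n1).
apply: leq_trans zQ _; apply: leq_trans (tauz Q Q0) _.
have base : (1 + tau Q <= (1 + 4 * K) * n ^ d)%N.
  have : (0 < n ^ d)%N by rewrite expn_gt0 n1.
  by move: sizeC tauQ; nia.
rewrite expnM -expnMn; case: c {tauz} => [|c]; first by rewrite !expn0.
by rewrite leq_exp2r.
Qed.
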